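(* Let $\delta=\frac1{12}$, $c=\frac12$, $\theta=\frac12$, $m=\frac45$, and let $$g(x)=mx+\theta,\qquad h(x)=c\left(\frac{x-\delta}{1-\delta}\right)^3,\qquad A=\{(x,y)\in[0,1]^2: h(x)\le y\le g(x)\}.$$ For every $\beta\ge1$ the region $A$ is invariant in the following sense: for every $N\ge1$, if $(Y_n^{(N)})_{1\le n\le N}$ is the solution on $[0,\infty)$ of the truncated system $$\frac{d}{dt}Y_n^{(N)}=2^{\frac{2\beta+1}{3}n-\frac{\beta+2}{3}}\left[\left(Y_{n-1}^{(N)}\right)^2-2Y_n^{(N)}Y_{n+1}^{(N)}\right],\qquad Y_n^{(N)}(0)=y_n,\qquad n=1,\dots,N,$$ with the conventions $Y_0^{(N)}=0$ and $Y_{N+1}^{(N)}=Y_N^{(N)}$, and if $(y_n,y_{n+1})\in A$ for all $1\le n\le N-1$, then $(Y_n^{(N)}(t),Y_{n+1}^{(N)}(t))\in A$ for all $1\le n\le N-1$ and all $t\ge0$.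
   Context: All quantities are real-valued; all objects are introduced in the claim. *)

(* Defs.v *)
(* Stdlib world: concrete real numbers [R]. *)
From Stdlib Require Import Reals.
Open Scope R_scope.

Definition delta : R := 1 / 12.
Definition c : R := 1 / 2.
Definition theta : R := 1 / 2.
Definition m : R := 4 / 5.

Definition g (x : R) : R := m * x + theta.
Definition h (x : R) : R := c * ((x - delta) / (1 - delta)) ^ 3.

Definition A (x y : R) : Prop :=
  (0 <= x <= 1) /\ (0 <= y <= 1) /\ (h x <= y <= g x).

Definition coeff (beta : R) (n : nat) : R :=
  Rpower 2 ((2 * beta + 1) / 3 * INR n - (beta + 2) / 3).

(* The unknowns are [Y 1], ..., [Y N]; [Y 0] and [Y (N + 1)] carry the two
   boundary conventions, and the other components, as well as the values at
   negative times, are irrelevant.  [D_in f d D t] is the derivative of [f]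
   at [t] relative to the domain [D], so the derivative at time 0 is
   one-sided. *)
Definition truncated_solution (beta : R) (N : nat) (y : nat -> R)
    (Y : nat -> R -> R) : Prop :=
  (forall t : R, 0 <= t -> Y 0%nat t = 0) /\
  (forall t : R, 0 <= t -> Y (N + 1)%nat t = Y N t) /\
  (forall n : nat, (1 <= n <= N)%nat ->
     Y n 0 = y n /\
     forall t : R, 0 <= t ->
       D_in (Y n)
         (fun s : R => coeff beta n *
            ((Y (n - 1)%nat s) ^ 2 - 2 * Y n s * Y (n + 1)%nat s))
         (fun s : R => 0 <= s) t).

(* Main.v *)
Require Import Defs.
From Stdlib Require Import Reals Lra Lia List.
Import ListNotations.
Open Scope R_scope.

(** The proof is a barrier argument: on each piece of the boundary of the
    region the vector field points inward, so no solution can leave.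

    Write [w, x, y, z] for four consecutive components and [r >= 2] for the
    ratio of consecutive coefficients.  Up to the factor [coeff beta n], the
    velocity of [(x, y)] is [(w^2 - 2xy, r (x^2 - 2yz))].
    - On the curve [y = h x] the worst case is [w = 1], [z = g y], [r = 2];
      there the required inequality is that a polynomial in [x] is positive
      ([lower_face_inward]).
    - On the curve [y = g x] the worst case is [w = 0], [z = h y], [r = 2];
      again a polynomial has to be positive ([upper_face_inward]).
    Both inequalities are strict, with a margin of about one thousandth.  At
    the last index the convention [Y (N + 1) = Y N] supplies the neighbour,
    and it respects both curves because the diagonal of the unit square lies
    between them.

    The sides of the square are not strictly repelling: the velocity across
    the top side vanishes at the corner [(1, 1)] when [z = 1/2], and the
    velocity across the left side vanishes when [w = 0].  They are treated by
    two other means.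
    - Nonnegativity holds without any reference to the region, since [Y n]
      solves a linear equation with nonnegative source
      ([truncated_solution_nonneg]).
    - The bound [Y n <= 1] is relaxed to [Y n <= 1 + e exp (L t)].  At that
      height the upward velocity is at most of the order of the excess
      [e exp (L t)] itself, because [2z >= 2 h 1 = 1], so for [L] large the
      barrier rises strictly faster than the solution.  The margins above
      absorb the small excess, which makes the enlarged region invariant up
      to a prescribed time ([expanded_region_invariant]); then [e] tends
      to 0. *)

(** * Regions with strictly inward boundary velocity *)

Definition nonneg (t : R) : Prop := 0 <= t.

Lemma D_in_eq_at (f d d' : R -> R) (D : R -> Prop) (t : R) :
  D_in f d D t -> d t = d' t -> D_in f d' D t.
Proof. unfold D_in; intros H E; rewrite <- E; exact H. Qed.

Lemma derivable_D_in (f d : R -> R) (t : R) :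
  derivable_pt_lim f t (d t) -> D_in f d nonneg t.
Proof.
  intros H. apply derivable_pt_lim_D_in in H.
  intros eps Heps. destruct (H eps Heps) as [a [Ha Hlim]].
  exists a; split; [exact Ha|]. intros s [[_ Hne] Hs].
  apply Hlim; repeat split; assumption.
Qed.

Lemma continue_in_pos (f : R -> R) (t : R) :
  continue_in f nonneg t -> 0 < f t ->
  exists e, 0 < e /\ forall s, 0 <= s -> Rabs (s - t) < e -> 0 < f s.
Proof.
  intros Hc Hf. destruct (Hc (f t) Hf) as [e [He Hlim]].
  exists e; split; [exact He|]. intros s Hs Hst.
  destruct (Req_dec t s) as [<-|Hne]; [exact Hf|].
  assert (H : Rabs (f s - f t) < f t).
  { apply Hlim; split; [split; [exact Hs|exact Hne]|exact Hst]. }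
  apply Rabs_def2 in H; lra.
Qed.

Lemma D_in_pos (f d : R -> R) (t : R) :
  D_in f d nonneg t -> 0 < f t ->
  exists e, 0 < e /\ forall s, 0 <= s -> Rabs (s - t) < e -> 0 < f s.
Proof. intros H; apply continue_in_pos; exact (cont_deriv _ _ _ _ H). Qed.

Lemma D_in_neg (f d : R -> R) (t : R) :
  D_in f d nonneg t -> f t < 0 ->
  exists e, 0 < e /\ forall s, 0 <= s -> Rabs (s - t) < e -> f s < 0.
Proof.
  intros H Hf. destruct (D_in_pos _ _ _ (Dopp _ _ _ _ H)) as [e [He Hp]].
  { lra. }
  exists e; split; [exact He|]. intros s Hs Hst; specialize (Hp s Hs Hst); lra.
Qed.

Lemma D_in_stays_nonneg (f d : R -> R) (t : R) :
  0 <= t -> D_in f d nonneg t -> 0 <= f t -> (f t = 0 -> 0 < d t) ->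
  exists e, 0 < e /\ forall s, t <= s < t + e -> 0 <= f s.
Proof.
  intros Ht H Hf Hd. destruct (Rle_lt_or_eq_dec _ _ Hf) as [Hpos|Hz].
  - destruct (D_in_pos _ _ _ H Hpos) as [e [He Hp]].
    exists e; split; [exact He|]. intros s Hs; apply Rlt_le, Hp; [lra|].
    apply Rabs_def1; lra.
  - symmetry in Hz; specialize (Hd Hz).
    destruct (H (d t) Hd) as [e [He Hlim]].
    exists e; split; [exact He|]. intros s Hs.
    destruct (Req_dec t s) as [<-|Hne]; [lra|].
    assert (Hq : Rabs ((f s - f t) / (s - t) - d t) < d t).
    { apply Hlim; split; [split; [unfold nonneg; lra|exact Hne]|].
      apply Rabs_def1; lra. }
    apply Rabs_def2 in Hq.
    replace (f s) with ((f s - f t) / (s - t) * (s - t))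
      by (rewrite Hz; field; lra).
    apply Rmult_le_pos; lra.
Qed.

Lemma common_window (I : Type) (idx : list I) (P : I -> R -> Prop) (t : R) :
  (forall i, In i idx ->
     exists e, 0 < e /\ forall s, t <= s < t + e -> P i s) ->
  exists e, 0 < e /\ forall i s, In i idx -> t <= s < t + e -> P i s.
Proof.
  induction idx as [|i0 idx IH]; intros H.
  - exists 1; split; [lra|]. intros i s [].
  - destruct (H i0 (or_introl eq_refl)) as [e1 [He1 H1]].
    destruct IH as [e2 [He2 H2]]. { intros i Hi; apply H; right; exact Hi. }
    exists (Rmin e1 e2); split; [apply Rmin_pos; assumption|].
    intros i s [<-|Hi] Hs; pose proof (Rmin_l e1 e2); pose proof (Rmin_r e1 e2).
    + apply H1; lra.
    + apply H2; [exact Hi|lra].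
Qed.

(** Strict inwardness on the active constraints is all that is needed: at
    the supremum of the times up to which all constraints hold, each of them
    is either positive, hence persists by continuity, or zero with positive
    derivative, hence becomes positive.  Finiteness of the family gives a
    common positive duration, so the supremum can only be [T]. *)
Lemma inward_region_invariant (I : Type) (idx : list I)
    (phi dphi : I -> R -> R) (T : R) :
  (forall i, In i idx -> 0 <= phi i 0) ->
  (forall i t, In i idx -> 0 <= t <= T -> D_in (phi i) (dphi i) nonneg t) ->
  (forall i t, In i idx -> 0 <= t <= T ->
     (forall j, In j idx -> 0 <= phi j t) -> phi i t = 0 -> 0 < dphi i t) ->
  forall i t, In i idx -> 0 <= t <= T -> 0 <= phi i t.
Proof.
  intros H0 HD Hin i1 t1 Hi1 Ht1.
  pose (E := fun t => 0 <= t <= T /\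
    forall i s, In i idx -> 0 <= s <= t -> 0 <= phi i s).
  destruct (completeness E) as [tau [Hub Hlub]].
  - exists T. intros t [Ht _]; lra.
  - exists 0; split; [lra|]. intros i s Hi Hs.
    replace s with 0 by lra. apply H0, Hi.
  - assert (Htau0 : 0 <= tau).
    { apply Hub; split; [lra|]. intros i s Hi Hs.
      replace s with 0 by lra. apply H0, Hi. }
    assert (HtauT : tau <= T). { apply Hlub. intros t [Ht _]; lra. }
    assert (Hbefore : forall i s, In i idx -> 0 <= s < tau -> 0 <= phi i s).
    { intros i s Hi Hs. destruct (Rle_lt_dec 0 (phi i s)) as [|Hneg]; [assumption|].
      exfalso. assert (tau <= s); [|lra].
      apply Hlub. intros t [Ht Hall].
      destruct (Rle_lt_dec t s) as [|Hst]; [assumption|].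
      specialize (Hall i s Hi); lra. }
    assert (Hat : forall i, In i idx -> 0 <= phi i tau).
    { intros i Hi. destruct (Rle_lt_dec 0 (phi i tau)) as [|Hneg]; [assumption|].
      exfalso.
      destruct (Rle_lt_or_eq_dec _ _ Htau0) as [Hpos|Hz];
        [|rewrite <- Hz in Hneg; specialize (H0 i Hi); lra].
      destruct (D_in_neg _ _ _ (HD i tau Hi (conj Htau0 HtauT)) Hneg)
        as [e [He Hn]].
      pose (s := Rmax 0 (tau - e / 2)).
      assert (Hs : 0 <= s < tau /\ tau - e / 2 <= s).
      { unfold s, Rmax; destruct Rle_dec; lra. }
      assert (phi i s < 0). { apply Hn; [lra|]. apply Rabs_def1; lra. }
      specialize (Hbefore i s Hi); lra. }
    destruct (common_window I idx (fun i s => 0 <= phi i s) tau) as [e [He Hafter]].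
    { intros i Hi. apply D_in_stays_nonneg with (dphi i).
      - exact Htau0.
      - apply HD; [exact Hi|lra].
      - apply Hat, Hi.
      - apply Hin; [exact Hi|lra|exact Hat]. }
    destruct (Rlt_le_dec t1 (tau + e)) as [Hlt|Hge].
    + destruct (Rlt_le_dec t1 tau); [apply Hbefore|apply Hafter]; auto; lra.
    + exfalso. assert (tau + e / 2 <= tau); [|lra].
      apply Hub; split; [lra|]. intros i s Hi Hs.
      destruct (Rlt_le_dec s tau); [apply Hbefore|apply Hafter]; auto; lra.
Qed.

(** * Nonnegativity for linear equations *)

Lemma D_in_exp_barrier (e L t : R) :
  D_in (fun s => e * exp (L * s)) (fun s => L * (e * exp (L * s))) nonneg t.
Proof.
  apply derivable_D_in.
  replace (L * (e * exp (L * t))) with (e * (exp (L * t) * (L * 1))) by ring.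
  apply derivable_pt_lim_scal.
  apply (derivable_pt_lim_comp (fun s => L * s) exp).
  - apply derivable_pt_lim_scal, derivable_pt_lim_id.
  - apply derivable_pt_lim_exp.
Qed.

(** Composing with [Rmax 0] turns continuity relative to the half-line into
    continuity on the whole line, where the extreme value theorem applies. *)
Lemma continue_in_bounded (a : R -> R) (T : R) :
  0 <= T -> (forall t, 0 <= t -> continue_in a nonneg t) ->
  exists M, forall t, 0 <= t <= T -> Rabs (a t) <= M.
Proof.
  intros HT Ha.
  destruct (continuity_ab_maj (fun t => Rabs (a (Rmax 0 t))) 0 T HT)
    as [tm [Hm _]].
  - intros t Ht. apply (continuity_pt_comp (fun t => a (Rmax 0 t)) Rabs);
      [|apply Rcontinuity_abs].
    intros eps Heps.
    destruct (Ha (Rmax 0 t) (Rmax_l 0 t) eps Heps) as [d [Hd Hlim]].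
    exists d; split; [exact Hd|]. intros s [_ Hs].
    destruct (Req_dec (Rmax 0 t) (Rmax 0 s)) as [E|Hne].
    + cbv beta; rewrite E. unfold Rdist; simpl. unfold Rdist.
      rewrite Rminus_diag, Rabs_R0. exact Heps.
    + apply Hlim; split; [split; [apply Rmax_l|exact Hne]|].
      simpl in *. unfold Rdist in *.
      apply Rle_lt_trans with (Rabs (s - t)); [|exact Hs].
      unfold Rmax, Rabs; repeat destruct Rle_dec; repeat destruct Rcase_abs; lra.
  - exists (Rabs (a (Rmax 0 tm))). intros t Ht.
    specialize (Hm t Ht). cbv beta in Hm. rewrite (Rmax_right 0 t) in Hm; [exact Hm|lra].
Qed.

Lemma le_of_exp_barrier (x L t e0 : R) :
  0 < e0 -> (forall e, 0 < e <= e0 -> x <= e * exp (L * t)) -> x <= 0.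
Proof.
  intros He0 H. destruct (Rle_lt_dec x 0) as [|Hx]; [assumption|exfalso].
  pose proof (exp_pos (L * t)) as Hp.
  set (E := exp (L * t)) in *.
  pose (e := Rmin e0 (x / (2 * E))).
  assert (He : 0 < e).
  { apply Rmin_pos; [exact He0|]. apply Rdiv_lt_0_compat; lra. }
  specialize (H e (conj He (Rmin_l _ _))).
  assert (e * E <= x / (2 * E) * E).
  { apply Rmult_le_compat_r; [lra|apply Rmin_r]. }
  replace (x / (2 * E) * E) with (x / 2) in * by (field; lra). lra.
Qed.

(** For [f' = b - a f] with [b >= 0], the barrier [- e exp ((M + 1) t)], with
    [M] a bound for [|a|], falls strictly faster than [f] can while [f] sits
    on it; letting [e] tend to 0 gives [f >= 0]. *)
Lemma linear_ode_nonneg (f a b : R -> R) :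
  (forall t, 0 <= t -> D_in f (fun s => b s - a s * f s) nonneg t) ->
  (forall t, 0 <= t -> continue_in a nonneg t) ->
  (forall t, 0 <= t -> 0 <= b t) ->
  0 <= f 0 ->
  forall t, 0 <= t -> 0 <= f t.
Proof.
  intros HD Ha Hb H0 T HT.
  destruct (continue_in_bounded a T HT Ha) as [M HM].
  enough (- f T <= 0) by lra.
  apply le_of_exp_barrier with (L := M + 1) (t := T) (e0 := 1); [lra|].
  intros e He.
  enough (0 <= f T + e * exp ((M + 1) * T)) by lra.
  refine (inward_region_invariant unit [tt]
    (fun _ s => f s + e * exp ((M + 1) * s))
    (fun _ s => (b s - a s * f s) + (M + 1) * (e * exp ((M + 1) * s))) T
    _ _ _ tt T _ _).
  - intros _ _. pose proof (exp_pos ((M + 1) * 0)). nra.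
  - intros _ t _ Ht. apply Dadd; [apply HD; lra|apply D_in_exp_barrier].
  - intros _ t _ Ht _ Hz. cbv beta in *.
    assert (Heta : 0 < e * exp ((M + 1) * t)).
    { apply Rmult_lt_0_compat; [lra|apply exp_pos]. }
    set (eta := e * exp ((M + 1) * t)) in *.
    replace (f t) with (- eta) by lra.
    specialize (HM t Ht). specialize (Hb t (proj1 Ht)).
    assert (- M <= a t) by (pose proof (Rle_abs (- a t)); rewrite Rabs_Ropp in *; lra).
    nra.
  - left; reflexivity.
  - lra.
Qed.

(** * Inward velocity on the two curves *)

(** How far the components may exceed 1.  It has to be well below the
    margins, about [0.0013], of the two polynomial inequalities below. *)
Definition slack : R := 1 / 10000.

(** With [s = (x - delta) / (1 - delta)], so that [x = (11 s + 1) / 12] and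
    [h x = s^3 / 2], this is the inequality
    [h' x (w^2 - 2 x y) < 2 (x^2 - 2 y z)] on the lower curve in its worst
    case [w = 1 + slack], [z = g y].  The minimum is about [0.00135], near
    [s = 39/50].  Expanding there as
    [c0 + c1 (s - 39/50) + (s - 39/50)^2 q s] leaves a quartic [q] with
    positive coefficients, and
    already [c0 + c1 u + (q 0) u^2] has negative discriminant. *)
Lemma rescaled_lower_poly_pos (s : R) :
  0 <= s ->
  0 < 2 * ((11 * s + 1) / 12) ^ 2 - 2 * s ^ 3 * (2 / 5 * s ^ 3 + 1 / 2)
      - 18 / 11 * s ^ 2 * ((1 + slack) ^ 2 - (11 * s + 1) / 12 * s ^ 3).
Proof.
  intros Hs. unfold slack.
  assert (H1 : 0 <= (s - 39 / 50) ^ 2) by apply pow2_ge_0.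
  assert (H2 : 0 <= s ^ 2) by apply pow2_ge_0.
  assert (H3 : 0 <= s ^ 3) by (apply pow_le; lra).
  assert (H4 : 0 <= s ^ 4) by (apply pow_le; lra).
  pose proof (Rmult_le_pos _ _ H1 Hs).
  pose proof (Rmult_le_pos _ _ H1 H2).
  pose proof (Rmult_le_pos _ _ H1 H3).
  pose proof (Rmult_le_pos _ _ H1 H4).
  (* The square at the vertex of c0 + c1 u + (q 0) u^2. *)
  pose proof (pow2_ge_0 (s - 39 / 50 + 18 / 100)).
  nra.
Qed.

(** The same rescaling of [y] on the upper curve, where [x = (y - 1/2) 5/4]:
    this is [m x y < 2 y h y - x^2].  The minimum is about [0.0014], near
    [s = 77/100], and expanding there leaves a quadratic quotient which
    exceeds [0.47] for [s >= 5/11], that is, for [y >= 1/2]. *)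
Lemma rescaled_upper_poly_pos (s : R) :
  5 / 11 <= s ->
  0 < (11 * s + 1) / 12 * s ^ 3
      - ((11 * s + 1) / 12 - 1 / 2) ^ 2 * (25 / 16)
      - ((11 * s + 1) / 12 - 1 / 2) * ((11 * s + 1) / 12).
Proof.
  intros Hs.
  assert (H1 : 0 <= (s - 77 / 100) ^ 2) by apply pow2_ge_0.
  (* The quotient by (s - 77/100)^2, with its constant term rounded down. *)
  assert (Hq : 47 / 100 <= - (39441 / 100000) + 1495 / 1000 * s + 11 / 12 * s ^ 2) by nra.
  pose proof (Rmult_le_compat_l _ _ _ H1 Hq).
  (* The square at the vertex of the remaining quadratic. *)
  pose proof (pow2_ge_0 (s - 77 / 100 + 57 / 10000)).
  nra.
Qed.

(** The derivative of [h], since [18 / 11 = 3 c / (1 - delta)]. *)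
Definition dh (x : R) : R := 18 / 11 * ((x - delta) / (1 - delta)) ^ 2.

(** [y = h x >= 0] forces [x >= delta], the range in which the polynomial
    inequality holds.  Replacing [r] by 2 requires [x^2 >= 2 y z], which is
    checked separately. *)
Lemma lower_face_inward (r w x y z : R) :
  2 <= r -> 0 <= w <= 1 + slack -> 0 <= x <= 1 + slack -> 0 <= y ->
  y = h x -> z <= g y ->
  dh x * (w ^ 2 - 2 * x * y) < r * (x ^ 2 - 2 * y * z).
Proof.
  intros Hr Hw Hx Hy Hyh Hz.
  unfold dh, h, g, c, m, theta in *.
  set (s := (x - delta) / (1 - delta)) in *.
  assert (Hxs : x = (11 * s + 1) / 12) by (unfold s, delta; field).
  assert (Hs : 0 <= s).
  { destruct (Rle_lt_dec 0 s) as [|Hneg]; [assumption|exfalso].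
    assert (s ^ 3 < 0); [|lra].
    assert (0 < s ^ 2) by nra. simpl in *; nra. }
  clearbody s.
  pose proof (rescaled_lower_poly_pos s Hs) as Hpoly.
  rewrite <- Hxs in Hpoly.
  assert (Hs3 : 0 <= s ^ 3) by (apply pow_le; lra).
  assert (Hyz : 2 * y * z <= s ^ 3 * (2 / 5 * s ^ 3 + 1 / 2)).
  { replace (2 * y) with (s ^ 3) by lra. apply Rmult_le_compat_l; lra. }
  (* Both sides are compared with (95/100)^2 s^2: x >= 95/100 s for the s that
     occur, all of them at most 1 + 2/10000. *)
  assert (Hpos : 0 <= x ^ 2 - 2 * y * z).
  { assert (s ^ 3 * (2 / 5 * s ^ 3 + 1 / 2) <= x ^ 2); [|lra].
    unfold slack in *.
    assert (Hs1 : s <= 1 + 2 / 10000) by lra.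
    assert (Hs2 : s ^ 2 <= 1 + 5 / 10000) by nra.
    assert (Hs3' : s ^ 3 <= 1 + 1 / 1000).
    { replace (s ^ 3) with (s * s ^ 2) by ring. nra. }
    assert (Hxge : 95 / 100 * s <= x) by lra.
    assert (Hx2 : 9025 / 10000 * s ^ 2 <= x ^ 2) by nra.
    assert (Hc : s * (2 / 5 * s ^ 3 + 1 / 2) <= 9025 / 10000) by nra.
    replace (s ^ 3 * (2 / 5 * s ^ 3 + 1 / 2))
      with (s ^ 2 * (s * (2 / 5 * s ^ 3 + 1 / 2))) by ring.
    assert (0 <= s ^ 2) by apply pow2_ge_0. nra. }
  assert (Hw2 : w ^ 2 <= (1 + slack) ^ 2) by (apply pow_incr; lra).
  assert (Hlhs : 18 / 11 * s ^ 2 * (w ^ 2 - 2 * x * y)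
     <= 18 / 11 * s ^ 2 * ((1 + slack) ^ 2 - x * s ^ 3)).
  { apply Rmult_le_compat_l; [pose proof (pow2_ge_0 s); lra|].
    replace (2 * x * y) with (x * s ^ 3) by (rewrite Hyh; field). lra. }
  nra.
Qed.

(** Here [x^2 - 2 y z] is negative, so the left side is largest for [r = 2],
    while the right side is smallest for [w = 0]. *)
Lemma upper_face_inward (r w x y z : R) :
  2 <= r -> 0 <= x -> y = g x -> h y <= z ->
  r * (x ^ 2 - 2 * y * z) < m * (w ^ 2 - 2 * x * y).
Proof.
  intros Hr Hx Hy Hz.
  unfold h, g, c, m, theta in *.
  set (s := (y - delta) / (1 - delta)) in *.
  assert (Hys : y = (11 * s + 1) / 12) by (unfold s, delta; field).
  clearbody s.
  pose proof (rescaled_upper_poly_pos s ltac:(lra)) as Hpoly.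
  rewrite <- Hys in Hpoly.
  assert (Hxy : x = (y - 1 / 2) * (5 / 4)) by lra.
  assert (Hyz : y * s ^ 3 <= 2 * y * z).
  { replace (2 * y * z) with (y * (2 * z)) by ring.
    apply Rmult_le_compat_l; lra. }
  assert (H0 : 0 <= x * y) by (apply Rmult_le_pos; lra).
  assert (Hx2 : x ^ 2 = (y - 1 / 2) ^ 2 * (25 / 16)) by (rewrite Hxy; field).
  assert (Hxy' : 4 / 5 * (x * y) = (y - 1 / 2) * y) by (rewrite Hxy; field).
  assert (Hgap : 4 / 5 * (x * y) < 2 * y * z - x ^ 2) by lra.
  pose proof (pow2_ge_0 w). nra.
Qed.

(** This is what stops growth at the top of the square: if [y >= 1] and
    [z >= h y], then [x^2 - 2 y z <= x^2 - y]. *)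
Lemma h_ge_half (x : R) : 1 <= x -> 1 / 2 <= h x.
Proof.
  intros Hx. unfold h, c.
  assert (H : 1 <= (x - delta) / (1 - delta)).
  { unfold delta. apply Rmult_le_reg_r with (1 - 1 / 12); [lra|].
    replace ((x - 1 / 12) / (1 - 1 / 12) * (1 - 1 / 12)) with (x - 1 / 12) by field. lra. }
  pose proof (pow_R1_Rle _ 3 H). lra.
Qed.

(** * The coefficients and the truncated system *)

Lemma coeff_pos (beta : R) (n : nat) : 0 < coeff beta n.
Proof. apply exp_pos. Qed.

Lemma coeff_succ (beta : R) (n : nat) :
  coeff beta (n + 1) = Rpower 2 ((2 * beta + 1) / 3) * coeff beta n.
Proof.
  unfold coeff. rewrite <- Rpower_plus, plus_INR. f_equal. simpl INR. field.
Qed.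

Lemma coeff_ratio_ge_2 (beta : R) : 1 <= beta -> 2 <= Rpower 2 ((2 * beta + 1) / 3).
Proof.
  intros Hb. rewrite <- (Rpower_1 2) at 1 by lra. apply Rle_Rpower; lra.
Qed.

Lemma coeff_incr (beta : R) (n N : nat) :
  1 <= beta -> (n <= N)%nat -> coeff beta n <= coeff beta N.
Proof.
  intros Hb Hn. apply Rle_Rpower; [lra|].
  apply le_INR in Hn. nra.
Qed.

Definition rhs (beta : R) (Y : nat -> R -> R) (n : nat) (s : R) : R :=
  coeff beta n * (Y (n - 1)%nat s ^ 2 - 2 * Y n s * Y (n + 1)%nat s).

(** The equation of [Y n] is linear in [Y n] with coefficient
    [2 coeff beta n * Y (n + 1)] and source [coeff beta n * (Y (n - 1))^2];
    such equations preserve nonnegativity whatever the sign of the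
    coefficient, so all components can be treated independently. *)
Lemma truncated_solution_nonneg (beta : R) (N : nat) (y : nat -> R)
    (Y : nat -> R -> R) :
  truncated_solution beta N y Y ->
  (forall n, (1 <= n <= N)%nat -> 0 <= y n) ->
  forall n t, (1 <= n <= N)%nat -> 0 <= t -> 0 <= Y n t.
Proof.
  intros [HY0 [HYN HY]] Hy n t Hn Ht.
  assert (Hcont : forall k s, (1 <= k <= N + 1)%nat -> 0 <= s ->
            continue_in (Y k) nonneg s).
  { intros k s Hk Hs. destruct (Nat.eq_dec k (N + 1)) as [->|Hk1].
    - destruct (HY N ltac:(lia)) as [_ HD].
      intros e He. destruct (cont_deriv _ _ _ _ (HD s Hs) e He) as [d [Hd Hlim]].
      exists d; split; [exact Hd|]. intros u Hu.
      rewrite HYN, HYN by (try exact Hs; apply Hu). exact (Hlim u Hu).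
    - destruct (HY k ltac:(lia)) as [_ HD].
      exact (cont_deriv _ _ _ _ (HD s Hs)). }
  destruct (HY n Hn) as [Hinit HD].
  apply (linear_ode_nonneg (Y n)
    (fun s => 2 * coeff beta n * Y (n + 1)%nat s)
    (fun s => coeff beta n * Y (n - 1)%nat s ^ 2)); [| | | |exact Ht].
  - intros s Hs. eapply D_in_eq_at; [exact (HD s Hs)|]. cbv beta; ring.
  - intros s Hs. unfold continue_in.
    apply (limit_mul (fun _ => 2 * coeff beta n) (Y (n + 1)%nat)).
    + intros e He. exists 1; split; [lra|].
      intros u _. simpl. unfold Rdist. rewrite Rminus_diag, Rabs_R0. exact He.
    + apply Hcont; [lia|exact Hs].
  - intros s _. pose proof (coeff_pos beta n).
    apply Rmult_le_pos; [lra|apply pow2_ge_0].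
  - rewrite Hinit; apply Hy, Hn.
Qed.

Lemma D_in_h_comp (f d : R -> R) (t : R) :
  D_in f d nonneg t ->
  D_in (fun s => h (f s)) (fun s => dh (f s) * d s) nonneg t.
Proof.
  intros Hf.
  assert (Hs : D_in (fun s => (f s - delta) * / (1 - delta))
                 (fun s => d s * / (1 - delta)) nonneg t).
  { eapply D_in_eq_at.
    - apply (Dmult nonneg (fun s => d s - 0) (fun _ => 0)
               (fun s => f s - delta) (fun _ => / (1 - delta))).
      + apply (Dminus nonneg d (fun _ => 0) f (fun _ => delta));
          [exact Hf|apply Dconst].
      + apply Dconst.
    - cbv beta; ring. }
  eapply D_in_eq_at.
  - apply (Dmult_const nonneg _ _ t c (Dmult _ _ _ _ _ _ Hs
      (Dmult _ _ _ _ _ _ Hs (Dmult _ _ _ _ _ _ Hs (Dconst nonneg 1 t))))).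
  - cbv beta. unfold dh, c, delta. field.
Qed.

(** * Invariance of the enlarged region *)

Inductive face := Cap (n : nat) | Lower (n : nat) | Upper (n : nat).

Definition faces (N : nat) : list face :=
  map Cap (seq 1 N) ++ map Lower (seq 1 (N - 1)) ++ map Upper (seq 1 (N - 1)).

(** The caps move upwards in time, so that the velocity can point strictly
    inward even where the side [Y n = 1] of the square is only weakly
    repelling. *)
Definition gap (e L : R) (Y : nat -> R -> R) (i : face) (s : R) : R :=
  match i with
  | Cap n => (1 + e * exp (L * s)) - Y n s
  | Lower n => Y (n + 1)%nat s - h (Y n s)
  | Upper n => g (Y n s) - Y (n + 1)%nat s
  end.

Definition dgap (e L beta : R) (Y : nat -> R -> R) (i : face) (s : R) : R :=
  match i with
  | Cap n => (0 + L * (e * exp (L * s))) - rhs beta Y n s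
  | Lower n => rhs beta Y (n + 1) s - dh (Y n s) * rhs beta Y n s
  | Upper n => m * rhs beta Y n s - rhs beta Y (n + 1) s
  end.

Lemma in_faces (N : nat) (i : face) :
  In i (faces N) <->
  match i with
  | Cap n => (1 <= n <= N)%nat
  | Lower n | Upper n => (1 <= n <= N - 1)%nat
  end.
Proof.
  unfold faces. rewrite !in_app_iff, !in_map_iff. split.
  - intros [[n [<- Hn]]|[[n [<- Hn]]|[n [<- Hn]]]]; apply in_seq in Hn; lia.
  - destruct i as [n|n|n]; intros Hn; [left|right; left|right; right];
      exists n; (split; [reflexivity|apply in_seq; lia]).
Qed.

(** The convention [Y (N + 1) = Y N] makes the pair at the end of the chain a
    point of the diagonal. *)
Lemma h_le_id_le_g (x : R) : 0 <= x <= 1 + slack -> h x <= x <= g x.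
Proof.
  intros Hx. unfold h, g, c, m, theta, slack in *.
  set (s := (x - delta) / (1 - delta)).
  assert (Hxs : x = (11 * s + 1) / 12) by (unfold s, delta; field).
  clearbody s. split; [|lra].
  assert (Hs : - 1 / 11 <= s <= 11 / 10) by lra.
  assert (H2 : s ^ 2 <= 121 / 100) by nra.
  replace (s ^ 3) with (s * s ^ 2) by ring.
  pose proof (pow2_ge_0 s). nra.
Qed.

(** The rate [L = 3 coeff beta N] beats the velocity of every component on its
    cap, which is at most [coeff beta n * eta (1 + eta)], where
    [eta = e exp (L t)] is the current excess.  The condition at time [T]
    keeps the excess within [slack], where the inequalities on the two curves
    hold. *)
Lemma expanded_region_invariant (beta : R) (N : nat) (y : nat -> R)
    (Y : nat -> R -> R) (e T : R) :
  1 <= beta ->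
  truncated_solution beta N y Y ->
  (forall n t, (1 <= n <= N)%nat -> 0 <= t -> 0 <= Y n t) ->
  (forall n, (1 <= n <= N)%nat -> y n <= 1) ->
  (forall n, (1 <= n <= N - 1)%nat -> h (y n) <= y (n + 1)%nat <= g (y n)) ->
  0 < e -> e * exp (3 * coeff beta N * T) <= slack ->
  forall i t, In i (faces N) -> 0 <= t <= T ->
    0 <= gap e (3 * coeff beta N) Y i t.
Proof.
  intros Hbeta [HY0 [HYN HY]] Hpos Hy1 Hyhg He HeT.
  assert (HD : forall n t, (1 <= n <= N)%nat -> 0 <= t ->
            D_in (Y n) (rhs beta Y n) nonneg t).
  { intros n t Hn Ht. apply (HY n Hn), Ht. }
  assert (Hinit : forall n, (1 <= n <= N)%nat -> Y n 0 = y n).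
  { intros n Hn. apply (HY n Hn). }
  apply inward_region_invariant with (dphi := dgap e (3 * coeff beta N) beta Y).
  - intros i Hi. apply in_faces in Hi. destruct i as [n|n|n]; simpl.
    + rewrite Hinit by lia. specialize (Hy1 n Hi).
      pose proof (exp_pos (3 * coeff beta N * 0)). nra.
    + rewrite !Hinit by lia. specialize (Hyhg n Hi). lra.
    + rewrite !Hinit by lia. specialize (Hyhg n Hi). lra.
  - intros i t Hi Ht. apply in_faces in Hi. destruct i as [n|n|n].
    + apply (Dminus nonneg (fun s => 0 + _) _ (fun s => 1 + _)).
      * apply Dadd; [apply Dconst|apply D_in_exp_barrier].
      * apply HD; [lia|lra].
    + apply Dminus; [apply HD; [lia|lra]|].
      apply D_in_h_comp, HD; [lia|lra].
    + apply (Dminus nonneg (fun s => m * _) _ (fun s => g _));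
        [|apply HD; [lia|lra]].
      eapply D_in_eq_at.
      * apply (Dadd nonneg (fun s => m * rhs beta Y n s) (fun _ => 0)
                 (fun s => m * Y n s) (fun _ => theta)); [|apply Dconst].
        apply Dmult_const, HD; [lia|lra].
      * cbv beta; ring.
  - intros i t Hi Ht Hall Hz. apply in_faces in Hi.
    set (L := 3 * coeff beta N) in *.
    pose (eta := e * exp (L * t)).
    assert (Heta : 0 < eta <= slack).
    { split; [apply Rmult_lt_0_compat; [exact He|apply exp_pos]|].
      apply Rle_trans with (2 := HeT). apply Rmult_le_compat_l; [lra|].
      assert (HLt : L * t <= L * T).
      { pose proof (coeff_pos beta N). apply Rmult_le_compat_l; unfold L; lra. }
      destruct HLt as [HLt| ->]; [left; apply exp_increasing, HLt|lra]. }
    (* Both families of bounds include the boundary conventions: k = 0 here,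
       and k = N in the next one. *)
    assert (Hcap : forall k, (k <= N)%nat -> 0 <= Y k t <= 1 + eta).
    { intros k Hk. destruct (Nat.eq_dec k 0) as [->|Hk0].
      - rewrite HY0; lra.
      - pose proof (Hall (Cap k) (proj2 (in_faces N (Cap k)) ltac:(simpl; lia))) as H.
        simpl in H; fold eta in H. split; [apply Hpos; [lia|lra]|lra]. }
    assert (Hcurve : forall k, (1 <= k <= N)%nat ->
              h (Y k t) <= Y (k + 1)%nat t <= g (Y k t)).
    { intros k Hk. destruct (Nat.eq_dec k N) as [->|HkN].
      - rewrite HYN by lra. apply h_le_id_le_g.
        specialize (Hcap N (le_n N)). lra.
      - pose proof (Hall (Lower k) (proj2 (in_faces N (Lower k)) ltac:(simpl; lia))).
        pose proof (Hall (Upper k) (proj2 (in_faces N (Upper k)) ltac:(simpl; lia))).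
        simpl in *; lra. }
    pose proof (coeff_ratio_ge_2 beta Hbeta) as Hr.
    set (r := Rpower 2 ((2 * beta + 1) / 3)) in *.
    destruct i as [n|n|n]; simpl in Hz |- *; fold eta in Hz |- *; unfold rhs;
      pose proof (coeff_pos beta n) as Hk;
      rewrite ?coeff_succ, ?Nat.add_sub; fold r.
    + pose proof (Hcap (n - 1)%nat ltac:(lia)) as Hw.
      pose proof (Hcurve n Hi) as [Hlow _].
      replace (Y n t) with (1 + eta) in * by lra.
      pose proof (h_ge_half (1 + eta) ltac:(lra)).
      pose proof (coeff_incr beta n N Hbeta ltac:(lia)).
      set (w := Y (n - 1)%nat t) in *. set (z := Y (n + 1)%nat t) in *.
      assert (Hw2 : w ^ 2 <= (1 + eta) ^ 2) by (apply pow_incr; lra).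
      unfold slack in *.
      assert (Hb : w ^ 2 - 2 * (1 + eta) * z <= 2 * eta) by nra.
      assert (coeff beta n * (w ^ 2 - 2 * (1 + eta) * z) <= coeff beta n * (2 * eta))
        by (apply Rmult_le_compat_l; lra).
      unfold L. nra.
    + pose proof (lower_face_inward r (Y (n - 1)%nat t) (Y n t) (Y (n + 1)%nat t)
        (Y (n + 1 + 1)%nat t) Hr) as H.
      pose proof (Hcap (n - 1)%nat ltac:(lia)).
      pose proof (Hcap n ltac:(lia)).
      pose proof (Hcap (n + 1)%nat ltac:(lia)).
      pose proof (Hcurve (n + 1)%nat ltac:(lia)).
      apply (Rmult_lt_compat_l _ _ _ Hk) in H; lra.
    + pose proof (upper_face_inward r (Y (n - 1)%nat t) (Y n t) (Y (n + 1)%nat t)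
        (Y (n + 1 + 1)%nat t) Hr) as H.
      pose proof (Hcap n ltac:(lia)).
      pose proof (Hcurve (n + 1)%nat ltac:(lia)).
      apply (Rmult_lt_compat_l _ _ _ Hk) in H; lra.
Qed.

Theorem theorem15 :
  forall beta : R, 1 <= beta ->
  forall N : nat, (1 <= N)%nat ->
  forall (y : nat -> R) (Y : nat -> R -> R),
    truncated_solution beta N y Y ->
    (forall n : nat, (1 <= n <= N - 1)%nat -> A (y n) (y (n + 1)%nat)) ->
    forall n : nat, (1 <= n <= N - 1)%nat ->
    forall t : R, 0 <= t -> A (Y n t) (Y (n + 1)%nat t).
Proof.
  intros beta Hbeta N HN y Y Hsol HA n Hn t Ht.
  assert (Hy : forall k, (1 <= k <= N)%nat -> 0 <= y k <= 1).
  { intros k Hk. destruct (Nat.eq_dec k N) as [->|HkN].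
    - destruct (HA (N - 1)%nat ltac:(lia)) as [_ [H _]].
      replace (N - 1 + 1)%nat with N in H by lia. exact H.
    - apply (HA k ltac:(lia)). }
  assert (Hpos : forall k s, (1 <= k <= N)%nat -> 0 <= s -> 0 <= Y k s).
  { apply (truncated_solution_nonneg beta N y Y Hsol). intros k Hk; apply Hy, Hk. }
  pose (L := 3 * coeff beta N).
  (* The largest e for which the excess at time t is still at most slack. *)
  pose (e0 := slack * exp (- (L * t))).
  assert (He0 : 0 < e0).
  { apply Rmult_lt_0_compat; [unfold slack; lra|apply exp_pos]. }
  assert (Hgap : forall e i, 0 < e <= e0 -> In i (faces N) -> 0 <= gap e L Y i t).
  { intros e i He Hi.
    apply (expanded_region_invariant beta N y Y e t); try assumption; try lra.
    - intros k Hk; apply Hy, Hk.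
    - intros k Hk; apply (HA k Hk).
    - apply Rle_trans with (e0 * exp (L * t)).
      + apply Rmult_le_compat_r; [left; apply exp_pos|lra].
      + unfold e0. rewrite Rmult_assoc, <- exp_plus, Rplus_opp_l, exp_0. lra. }
  assert (Hcap : forall k, (1 <= k <= N)%nat -> 0 <= Y k t <= 1).
  { intros k Hk. split; [apply Hpos; assumption|].
    enough (Y k t - 1 <= 0) by lra.
    apply (le_of_exp_barrier _ L t e0 He0). intros e He.
    pose proof (Hgap e (Cap k) He (proj2 (in_faces N (Cap k)) Hk)) as H.
    simpl in H. lra. }
  pose proof (Hgap e0 (Lower n) ltac:(lra) (proj2 (in_faces N (Lower n)) Hn)) as Hl.
  pose proof (Hgap e0 (Upper n) ltac:(lra) (proj2 (in_faces N (Upper n)) Hn)) as Hu.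
  simpl in Hl, Hu.
  repeat split; try apply Hcap; try lia; lra.
Qed.
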